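(* Let $C_{12},C_{13},C_{23}$ be compatible bivariate copulas, and let $C_{ji}(u,v):=C_{ij}(v,u)$ for $1\le i<j\le 3$. A $3$-copula $\widetilde C$ has bivariate marginals $\widetilde C(u_1,u_2,1)=C_{12}(u_1,u_2)$, $\widetilde C(u_1,1,u_3)=C_{13}(u_1,u_3)$, $\widetilde C(1,u_2,u_3)=C_{23}(u_2,u_3)$ if and only if there exist three families of bivariate copulas $\mathbf C_1=\{C^1_t\}_{t\in[0,1]}$, $\mathbf C_2=\{C^2_t\}_{t\in[0,1]}$, $\mathbf C_3=\{C^3_t\}_{t\in[0,1]}$ such that for all $u_1,u_2,u_3\in[0,1]$, \[ \widetilde C(u_1,u_2,u_3)=(C_{13}\star_{\mathbf C_3}C_{32})(u_1,u_3,u_2)=(C_{12}\star_{\mathbf C_2}C_{23})(u_1,u_2,u_3)=(C_{21}\star_{\mathbf C_1}C_{13})(u_2,u_1,u_3). \]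
   Context: A bivariate copula is a distribution function on $[0,1]^2$ with uniform $[0,1]$ marginals; a $3$-copula is a distribution function on $[0,1]^3$ with uniform $[0,1]$ one-dimensional marginals. Bivariate copulas $C_{12},C_{13},C_{23}$ are compatible if some $3$-copula has them as its bivariate marginals in the sense stated in the claim. For bivariate copulas $A,B$ and a family $\mathbf C=\{C_t\}_{t\in[0,1]}$ of bivariate copulas, $(A\star_{\mathbf C} B)(x,y,z)=\int_{0}^{y} C_t\!\left(\tfrac{\partial}{\partial t} A(x,t),\tfrac{\partial}{\partial t} B(t,z)\right) dt$ (partial derivatives existing a.e.). *)

(* Defs.v *)
From HB Require Import structures.
From mathcomp Require Import all_boot all_order all_algebra.
From mathcomp Require Import all_classical all_reals all_analysis.
Set Implicit Arguments. Unset Strict Implicit. Unset Printing Implicit Defensive.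
Import Order.TTheory GRing.Theory Num.Theory.
Import numFieldNormedType.Exports.
Local Open Scope classical_set_scope.
Local Open Scope ring_scope.

Section Copulas.
Variable R : realType.

Definition in01 (x : R) := 0 <= x <= 1.

(* A bivariate copula, represented as a function R -> R -> R whose
   restriction to [0,1]^2 is a copula (values outside are irrelevant). *)
Definition is_copula2 (C : R -> R -> R) : Prop :=
  (forall u, in01 u -> [/\ C u 0 = 0, C 0 u = 0, C u 1 = u & C 1 u = u]) /\
  (forall u1 u2 v1 v2, in01 u1 -> in01 u2 -> in01 v1 -> in01 v2 ->
     u1 <= u2 -> v1 <= v2 ->
     0 <= C u2 v2 - C u2 v1 - C u1 v2 + C u1 v1).

Definition is_copula3 (C : R -> R -> R -> R) : Prop :=
  [/\ (forall u v, in01 u -> in01 v ->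
         [/\ C 0 u v = 0, C u 0 v = 0 & C u v 0 = 0]),
      (forall u, in01 u -> [/\ C u 1 1 = u, C 1 u 1 = u & C 1 1 u = u]) &
      (forall a1 b1 a2 b2 a3 b3,
         in01 a1 -> in01 b1 -> in01 a2 -> in01 b2 -> in01 a3 -> in01 b3 ->
         a1 <= b1 -> a2 <= b2 -> a3 <= b3 ->
         0 <= C b1 b2 b3 - C a1 b2 b3 - C b1 a2 b3 - C b1 b2 a3
              + C a1 a2 b3 + C a1 b2 a3 + C b1 a2 a3 - C a1 a2 a3)].

Definition has_marginals (C : R -> R -> R -> R) (C12 C13 C23 : R -> R -> R) :=
  forall u1 u2 u3, in01 u1 -> in01 u2 -> in01 u3 ->
    [/\ C u1 u2 1 = C12 u1 u2, C u1 1 u3 = C13 u1 u3 & C 1 u2 u3 = C23 u2 u3].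

Definition compatible (C12 C13 C23 : R -> R -> R) : Prop :=
  exists C, is_copula3 C /\ has_marginals C C12 C13 C23.

Definition transp (C : R -> R -> R) : R -> R -> R := fun u v => C v u.

(* A family {C_t}_{t in [0,1]} of bivariate copulas; we require (as usual)
   that t |-> C_t(u,v) is Borel measurable on [0,1] for each (u,v). *)
Definition copula_family (Cf : R -> R -> R -> R) : Prop :=
  (forall t, in01 t -> is_copula2 (Cf t)) /\
  (forall u v : R, measurable_fun (`[0%R, 1%R] : set R) (fun t : R => Cf t u v)).

(* (A *_C B)(x,y,z) = int_0^y C_t(d/dt A(x,t), d/dt B(t,z)) dt,
   Lebesgue integral; derivatives via derive1 (they exist a.e.). *)
Definition star (A B : R -> R -> R) (Cf : R -> R -> R -> R) (x y z : R) : R :=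
  Rintegral (@lebesgue_measure R) (`[0%R, y] : set R)
    (fun t => Cf t (derive1 (fun s => A x s) t) (derive1 (fun s => B s z) t)).

End Copulas.

(* Main.v *)
Require Import Defs.
From HB Require Import structures.
From mathcomp Require Import all_boot all_order all_algebra.
From mathcomp Require Import all_classical all_reals all_analysis.
From mathcomp Require Import measurable_realfun ring lra.
Import Order.TTheory GRing.Theory Num.Theory.
Import numFieldNormedType.Exports.
Set Implicit Arguments. Unset Strict Implicit. Unset Printing Implicit Defensive.
Local Open Scope classical_set_scope.
Local Open Scope ring_scope.

(** The marginals are recovered from a star product because a copula [C_t] has
uniform margins and a section of a bivariate copula is 1-Lipschitz, hence the
integral of its a.e. derivative.  Conversely, the derivative
[H_t(x, z) = d/dt K(x, t, z)] of a 3-copula [K] exists, for almost every [t],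
simultaneously for all rational [x, z], and is a subcopula in the variables
[d/dt K(x, t, 1)], [d/dt K(1, t, z)] (this is the conditional law given the middle
coordinate).  Sklar's theorem extends it to a copula [C_t]; to keep [t |-> C_t(u, v)]
measurable the extension is the limit of an explicit interpolation scheme.  The
identity [C_t(d/dt K(x, t, 1), d/dt K(1, t, z)) = d/dt K(x, t, z)] passes from
rational to arbitrary [x, z] for almost every [t], because both sides move by at
most the increments of the margins, whose integrals are small. *)

(** * Truncation to the unit interval, and nondecreasing 1-Lipschitz functions *)

Section clamp.
Variable R : realType.
Implicit Types s t : R.

Definition clamp01 s : R := Num.max 0 (Num.min 1 s).

Lemma clamp01E s :
  clamp01 s = if s < 0 then 0 else if 1 < s then 1 else s.
Proof.
rewrite /clamp01; have [h|h] := ltP 1 s.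
  by rewrite max_r ?ler01// ifN// -leNgt; lra.
by have [k|k] := ltP s 0; rewrite ?max_l ?max_r// ltW.
Qed.

Lemma clamp01_in s : in01 (clamp01 s).
Proof. by rewrite /in01 clamp01E; do 2?case: ltP => ?; lra. Qed.

Lemma clamp01_id s : in01 s -> clamp01 s = s.
Proof. by rewrite /in01 clamp01E => ?; do 2?case: ltP => ?; lra. Qed.

Lemma clamp01_le s t : s <= t ->
  clamp01 s <= clamp01 t /\ clamp01 t - clamp01 s <= t - s.
Proof. by rewrite !clamp01E => ?; do 4?case: ltP => ?; split; lra. Qed.

(** One two-sided inequality says that both [F] and [id - F] are nondecreasing on [0,1], so each of
    them has a Stieltjes measure. *)
Definition lip01 (F : R -> R) :=
  forall s t, in01 s -> in01 t -> s <= t -> 0 <= F t - F s <= t - s.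

End clamp.

(** * Densities of 1-Lipschitz distribution functions *)

Section stieltjes_density.
Variables (R : realType) (F : R -> R).
Hypothesis FL : lip01 F.

Local Notation mu := (@lebesgue_measure R).

Let G s := F (clamp01 s).
Let G' s := s - F (clamp01 s).

Let GE s t : s <= t -> 0 <= G t - G s <= t - s.
Proof.
move=> st; have [c1 c2] := clamp01_le st.
by have := FL (clamp01_in s) (clamp01_in t) c1; rewrite /G; lra.
Qed.

Let Gnd : {homo G : x y / x <= y}.
Proof. by move=> x y /GE; lra. Qed.

Let G'nd : {homo G' : x y / x <= y}.
Proof. by move=> x y /GE; rewrite /G /G'; lra. Qed.

Let Gcont : continuous G.
Proof.
move=> x; apply/cvgrPdist_lt => e e0; near=> y.
have: `|x - y| < e by near: y; exact: cvgr_dist_lt.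
case: (leP x y) => [xy|/ltW yx].
  have := GE xy; rewrite ler0_norm ?subr_le0// => h1.
  by rewrite ler0_norm; lra.
have := GE yx; rewrite ger0_norm ?subr_ge0// => h1.
by rewrite ger0_norm; lra.
Unshelve. all: by end_near. Qed.

Let Grc : right_continuous G.
Proof. exact: right_continuousW. Qed.

Let G'rc : right_continuous G'.
Proof.
apply: right_continuousW => x; apply: cvgB; first exact: cvg_id.
exact: Gcont.
Qed.

#[local] HB.instance Definition _ := isCumulative.Build R _ R G Gnd Grc.
#[local] HB.instance Definition _ := isCumulative.Build R _ R G' G'nd G'rc.

Let nu := lebesgue_stieltjes_measure G.
Let nu' := lebesgue_stieltjes_measure G'.

Let stieltjes_oc (f : cumulative R R) (a b : R) : a <= b ->
  lebesgue_stieltjes_measure f `]a, b]%classic = (f b - f a)%:E.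
Proof.
move=> ab; rewrite /lebesgue_stieltjes_measure /measure_extension measurable_mu_extE/=.
  by rewrite wlength_itv_bnd.
exact: is_ocitv.
Qed.

(* [nu] and [nu'] are the Stieltjes measures of [F] and [id - F], so [nu <= mu]. *)
Let nuD A : measurable A -> mu A = (nu A + nu' A)%E.
Proof.
move=> mA.
rewrite -[RHS](measure_addE nu nu' A); apply: lebesgue_measure_unique => // X.
move=> /ocitvP[->|[[a b] /= ab ->]].
  by rewrite !measure0.
rewrite [RHS]measure_addE /nu /nu' /lebesgue_measure stieltjes_oc ?ltW//=.
rewrite (stieltjes_oc G (ltW ab)) (stieltjes_oc G' (ltW ab)).
by rewrite -EFinD; congr EFin; rewrite /= /G /G'; ring.
Qed.

Let m01 : @measurable _ (measurableTypeR R) `]0, 1]%classic.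
Proof. exact: measurable_itv. Qed.

Let nufin : (nu (`]0%R, 1%R]%classic : set R) < +oo)%E.
Proof. by rewrite /nu stieltjes_oc// ltry. Qed.

(** The restriction to ]0,1] carries the finite measure structure that Radon-Nikodym asks for. *)
Let rho := mfrestr m01 nufin.

Let rho_dom : rho `<< mu.
Proof.
apply/null_content_dominatesP => A mA A0.
have le_rho : (rho A <= mu A)%E.
  rewrite (nuD mA) (@le_trans _ _ (nu A))//.
    by rewrite /rho /mfrestr /mrestr le_measure ?inE//; exact: measurableI.
  by rewrite leeDl.
by apply/eqP; rewrite -measure_le0 (le_trans le_rho)//= A0.
Qed.

(** The Stieltjes measure of [F] is dominated by Lebesgue measure, so Radon-Nikodym yields [f]; the
    Lebesgue differentiation theorem then identifies [f] with the derivative of [F] almost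
    everywhere. *)
Lemma lip01_density : exists f : R -> R,
  [/\ measurable_fun setT f, forall t, 0 <= f t,
      {ae mu, forall t, 0 < t < 1 -> derivable F t 1 /\ derive1 F t = f t} &
      forall y, in01 y -> (\int[mu]_(t in `[0%R, y]) (f t)%:E = (F y - F 0)%:E)%E].
Proof.
have [f [f0 ffin fint fE]] := radon_nikodym_sigma_finite rho_dom.
have fineE : EFin \o (fine \o f) = f.
  by apply/funext => t /=; rewrite fineK.
have gint : mu.-integrable setT (EFin \o (fine \o f)) by rewrite fineE.
have Fint y : in01 y ->
    (\int[mu]_(t in `[0%R, y]) (fine (f t))%:E = (F y - F 0)%:E)%E.
  move=> y01; under eq_integral do rewrite fineK//.
  rewrite -fE; last exact: measurable_itv.
  transitivity (nu (`]0, y]%classic : set R)).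
    rewrite /rho /mfrestr /mrestr; congr (lebesgue_stieltjes_measure G _).
    apply/seteqP; split => t /=; rewrite !in_itv/=; move: y01; rewrite /in01; lra.
  rewrite /nu stieltjes_oc; last by case/andP: y01.
  by rewrite /= /G !clamp01_id// /in01; lra.
exists (fine \o f); split => //.
- by apply/measurable_EFinP; case/integrableP: gint.
- by move=> t /=; rewrite fine_ge0.
have : locally_integrable setT (fine \o f).
  by apply: open_integrable_locally => //; exact: openT.
move=> /lebesgue_differentiation.
apply: filterS; first exact: (ae_filter_ringOfSetsType mu).
move=> t ft /andP[t0 t1].
have intf1 : mu.-integrable `[0, 1]%classic (EFin \o (fine \o f)).
  by apply: integrableS gint => //; exact: measurable_itv.
have [|dI eI] := FTC1_lebesgue_pt t1 intf1 _ ft; first by rewrite lte_fin.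
(* The integral formula is available on [0,1] only, which contains a neighbourhood of the interior
   point [t]. *)
have FE : \near t, (\int[mu]_(s in `[0%R, t]) fine (f s))%R + F 0 = F t.
  have : \forall s \near t, s \in `]0, 1[.
    by apply: near_in_itvoo; rewrite in_itv/= t0.
  apply: filterS => s; rewrite in_itv/= => s01.
  by rewrite /Rintegral Fint /=; rewrite ?/in01; lra.
have dI' : is_derive t 1 (fun s => (\int[mu]_(r in `[0%R, s]) fine (f r))%R)
    (fine (f t)) by apply: DeriveDef => //; rewrite -derive1E.
have := is_deriveD dI' (is_derive_cst (F 0) t 1); rewrite addr0.
by move=> /(near_eq_is_derive FE)[dF eF]; split => //; rewrite derive1E.
Qed.
End stieltjes_density.

(** * Almost everywhere equality and integrals *)

Section integral_ae.
Local Open Scope ereal_scope.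
Context d (T : measurableType d) (R : realType) (mu : {measure set T -> \bar R}).

Import HBNNSimple.

Let ge0_ae_le_integralT (f g : T -> \bar R) :
  (forall x, 0 <= f x) -> (forall x, 0 <= g x) ->
  {ae mu, forall x, f x <= g x} ->
  \int[mu]_x f x <= \int[mu]_x g x.
Proof.
move=> f0 g0 [N [mN N0 fgN]]; rewrite (ge0_integralTE mu f0) (ge0_integralTE mu g0).
apply: ge_ereal_sup => _ /= [h hf <-].
pose h' := mul_nnsfun h (indic_nnsfun R (measurableC mN)).
apply: ereal_sup_ubound => /=; exists h'.
  move=> x /=; rewrite /mindic indicE; case: (boolP (x \in ~` N)) => xN; last first.
    by rewrite mulr0.
  rewrite mulr1 (le_trans (hf x))//; move: xN; rewrite inE/= => xN.
  by apply: contrapT => fg; apply: xN; exact: fgN.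
rewrite -[RHS](_ : sintegral mu (h \_ setT) = _); last by rewrite patch_setT.
rewrite -[LHS](_ : sintegral mu (h' \_ setT) = _); last by rewrite patch_setT.
rewrite -!integral_nnsfun//.
apply: ge0_ae_eq_integral => //.
- by apply/measurable_EFinP.
- by apply/measurable_EFinP.
- by move=> x _; rewrite lee_fin.
- by move=> x _; rewrite lee_fin.
exists N; split => // x /= hx; apply: contrapT => xN; apply: hx => _.
by rewrite /= /mindic indicE mem_set ?mulr1.
Qed.

Let ge0_ae_eq_integralT (f g : T -> \bar R) :
  (forall x, 0 <= f x) -> (forall x, 0 <= g x) ->
  {ae mu, forall x, f x = g x} ->
  \int[mu]_x f x = \int[mu]_x g x.
Proof.
move=> f0 g0 fg; apply/eqP; rewrite eq_le !ge0_ae_le_integralT//.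
  by apply: filterS fg => x ->.
by apply: filterS fg => x ->.
Qed.

(* Unlike [ae_eq_integral], no measurability is assumed: the library integral is
   a supremum over simple functions, and a simple function can be cut to [0] on
   a null set. *)
Lemma ae_eq_integral_nomeas D (f g : T -> \bar R) :
  {ae mu, forall x, D x -> f x = g x} ->
  \int[mu]_(x in D) f x = \int[mu]_(x in D) g x.
Proof.
move=> fg; rewrite [LHS]integral_mkcond [RHS]integral_mkcond integralE [RHS]integralE.
have fg' : {ae mu, forall x, (f \_ D) x = (g \_ D) x}.
  by apply: filterS fg => x fgx; rewrite !patchE; case: ifPn => //; rewrite inE.
by congr (_ - _); apply: ge0_ae_eq_integralT => //;
  apply: filterS fg' => x; rewrite ?funeposE ?funenegE => ->.
Qed.

Lemma ae_eq0_of_small_majorant D (phi : T -> R) : measurable D ->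
  (forall e : R, (0 < e)%R -> exists g : T -> R,
    [/\ measurable_fun D g, forall x, D x -> (0 <= g x)%R,
        \int[mu]_(x in D) (g x)%:E <= e%:E &
        {ae mu, forall x, D x -> (`|phi x| <= g x)%R}]) ->
  {ae mu, forall x, D x -> phi x = 0%R}.
Proof.
move=> mD H.
have e0 n : (0 < n.+1%:R^-1 :> R)%R by [].
have [g gP] := choice (fun n => H _ (e0 n)).
pose G x := einfs (fun n => (g n x)%:E) 0%N.
have mG : measurable_fun D G.
  apply: (@measurable_fun_einfs _ _ _ D (fun n x => (g n x)%:E)) => n.
  by have [mg _ _ _] := gP n; exact/measurable_EFinP.
have Gle x n : G x <= (g n x)%:E.
  by apply: ereal_inf_lbound; exists n.
have G0 x : D x -> 0 <= G x.
  move=> Dx; apply: le_ereal_inf_tmp => _ [n _ <-].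
  by rewrite lee_fin; have [_ + _ _] := gP n; exact.
have intG : \int[mu]_(x in D) G x = 0.
  apply/eqP; rewrite eq_le integral_ge0 ?andbT//.
  apply/lee_addgt0Pr => e eps0; rewrite add0e.
  have [n ne] : exists n, (n.+1%:R^-1 <= e)%R.
    have [n _ /(_ n (leqnn _)) ne] := near_infty_natSinv_lt (PosNum eps0).
    by exists n; exact/ltW.
  have [mg g0 gi _] := gP n.
  apply: (@le_trans _ _ (\int[mu]_(x in D) (g n x)%:E)); last first.
    by rewrite (le_trans gi)// lee_fin.
  apply: ge0_le_integral => //; first exact/measurable_EFinP.
have : G = cst 0 %[ae mu in D].
  apply/ae_eq_integral_abs => //; rewrite -intG.
  by apply: eq_integral => x; rewrite inE => Dx; rewrite gee0_abs ?G0.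
have : {ae mu, forall x n, D x -> (`|phi x| <= g n x)%R}.
  by apply/ae_foralln => n; have [_ _ _ ] := gP n.
apply: filterS2 => x phig Gx Dx.
apply/eqP; rewrite -normr_eq0 eq_le normr_ge0 andbT -lee_fin.
have -> : 0%:E = G x by rewrite Gx.
by apply: le_ereal_inf_tmp => _ [n _ <-]; rewrite lee_fin phig.
Qed.

End integral_ae.

(** * Derivatives at interior points of the unit interval *)

Section derive01.
Variable R : realType.
Implicit Types F G : R -> R.

Lemma near01 (t : R) : 0 < t < 1 -> \forall s \near t, in01 s.
Proof.
move=> t01; have : \forall s \near t, s \in `]0, 1[.
  by apply: near_in_itvoo; rewrite in_itv.
by apply: filterS => s; rewrite in_itv/= /in01; lra.
Qed.

Lemma derive1_eq01 F G t : 0 < t < 1 -> (forall s, in01 s -> F s = G s) ->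
  derive1 F t = derive1 G t.
Proof.
move=> t01 FG; rewrite !derive1E; apply: near_eq_derive.
by apply: filterS (near01 t01) => s; exact: FG.
Qed.

Lemma derive_ge0_of_homo F t : 0 < t < 1 ->
  (forall s r, in01 s -> in01 r -> s <= r -> F s <= F r) ->
  derivable F t 1 -> 0 <= derive1 F t.
Proof.
move=> t01 Fh dF; rewrite derive1E; apply: limr_ge => //.
have [_/posnumP[e] ball_e] := near01 t01.
exists e%:num => //= h he h0.
have h01 : in01 (h + t).
  apply: ball_e; rewrite /ball/= opprD addrCA subrr addr0 normrN.
  by move: he; rewrite /= sub0r normrN.
have t01' : in01 t by rewrite /in01; lra.
rewrite [h *: 1]mulr1 /GRing.scale/=.
have [h_lt0|h_ge0] := ltP h 0.
  apply: mulr_le0; first by rewrite invr_le0 ltW.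
  by rewrite subr_le0; apply: Fh => //; lra.
apply: mulr_ge0; first by rewrite invr_ge0.
by rewrite subr_ge0; apply: Fh => //; lra.
Qed.

End derive01.

Section in01.
Variable R : realType.

Lemma in01_0 : in01 (0 : R). Proof. by rewrite /in01; lra. Qed.

Lemma in01_1 : in01 (1 : R). Proof. by rewrite /in01; lra. Qed.

Lemma aeleb_filter : Filter (nbhs (almost_everywhere (@lebesgue_measure R))).
Proof. exact: (ae_filter_ringOfSetsType (@lebesgue_measure R)). Qed.

(** Two-sided derivatives are controlled only inside ]0,1[; the two endpoints form a null set. *)
Lemma ae_interior01 (P : R -> Prop) :
  {ae @lebesgue_measure R, forall t, 0 < t < 1 -> P t} ->
  {ae @lebesgue_measure R, forall t, in01 t -> P t}.
Proof.
have ? := aeleb_filter; have ae_neq a : {ae @lebesgue_measure R, forall t, t <> a}.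
  exists [set a]; split => [||t /= /contrapT ->//].
    exact: measurable_set1.
  exact: lebesgue_measure_set1.
move=> HP; have := ae_neq 0; have := ae_neq 1; move: HP; apply: filterS3.
move=> t Pt /eqP t1 /eqP t0 t01; apply: Pt; move: t01; rewrite /in01.
by rewrite !lt_neqAle t1 eq_sym t0 => /andP[-> ->].
Qed.
End in01.

#[local] Hint Resolve in01_0 in01_1 : core.

(** * Marginals of a star product *)

Section margins.
Variable R : realType.
Implicit Types (A B C : R -> R -> R).

Local Notation mu := (@lebesgue_measure R).

(** Over an interval [s,t], the strips of width [0,u] and [u,1] both have nonnegative mass; the
    first gives monotonicity and the second the Lipschitz bound. *)
Lemma copula2_lip C u : is_copula2 C -> in01 u ->
  lip01 (C u) /\ lip01 (C ^~ u).
Proof.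
move=> [Cb Ci] u01.
have u0 : 0 <= u by case/andP: u01.
have u1 : u <= 1 by case/andP: u01.
split=> s t s01 t01 st.
  have := Ci 0 u s t (in01_0 R) u01 s01 t01 u0 st.
  have := Ci u 1 s t u01 (in01_1 R) s01 t01 u1 st.
  have [_ -> _ ->] := Cb _ s01; have [_ -> _ ->] := Cb _ t01.
  by move=> *; apply/andP; split; lra.
have := Ci s t 0 u s01 t01 (in01_0 R) u01 st u0.
have := Ci s t u 1 s01 t01 u01 (in01_1 R) st u1.
have [-> _ -> _] := Cb _ s01; have [-> _ -> _] := Cb _ t01.
by move=> *; apply/andP; split; lra.
Qed.

Lemma transp_copula2 C : is_copula2 C -> is_copula2 (transp C).
Proof.
move=> [Cb Ci]; split => [u /Cb[]//|u1 u2 v1 v2 *].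
by have : 0 <= C v2 u2 - C v2 u1 - C v1 u2 + C v1 u1;
  [exact: Ci|rewrite /transp; lra].
Qed.

Lemma derive1_lip01 (F : R -> R) (t : R) : lip01 F -> 0 < t < 1 -> derivable F t 1 ->
  in01 (derive1 F t).
Proof.
move=> FL t01 dF; apply/andP; split.
  by apply: derive_ge0_of_homo => // s r s01 r01 /(FL _ _ s01 r01); lra.
have : 0 <= derive1 (fun s => s - F s) t.
  apply: derive_ge0_of_homo => //.
    by move=> s r s01 r01 /(FL _ _ s01 r01); lra.
  by apply: derivableB.
rewrite derive1E deriveB// derive_id -derive1E; lra.
Qed.

(** The condition on [phi] is limited to points where [F] is derivable: there the derivative lies in
    [0,1], where the boundary conditions of a copula [C_t] apply. *)
Lemma lip01_RintegralE (F phi : R -> R) (y : R) : lip01 F -> F 0 = 0 -> in01 y ->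
  {ae mu, forall t, 0 < t < 1 -> derivable F t 1 -> phi t = derive1 F t} ->
  Rintegral mu `[0, y]%classic phi = F y.
Proof.
move=> FL F0 y01 phiE; have ? := aeleb_filter R; have [f [mf f0 df If]] := lip01_density FL.
have := If y y01; rewrite F0 subr0 => Ify.
rewrite /Rintegral -[RHS]/(fine (F y)%:E) -Ify.
congr fine; apply: ae_eq_integral_nomeas.
have : {ae mu, forall t, 0 < t < 1 -> phi t = f t}.
  move: phiE df; apply: filterS2 => t h1 h2 t01.
  by have [dF <-] := h2 t01; exact: h1.
move/ae_interior01; apply: filterS => t h /=; rewrite in_itv/= => ty.
by rewrite h//; move: ty y01; rewrite /in01; lra.
Qed.

Variables (A B : R -> R -> R) (Cf : R -> R -> R -> R).
Hypotheses (hA : is_copula2 A) (hB : is_copula2 B) (hC : copula_family Cf).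

(** At [z = 1] the second argument of [C_t] is the derivative of the identity, and [C_t(u, 1) = u]
    leaves the derivative of [A x]. *)
Lemma star_marginr x y : in01 x -> in01 y -> star A B Cf x y 1 = A x y.
Proof.
move=> x01 y01; have [LA _] := copula2_lip hA x01.
apply: (lip01_RintegralE LA) => //; first by have [] := hA.1 _ x01.
apply: aeW => t t01 dA.
rewrite (@derive1_eq01 _ (fun s => B s 1) id)//; last by move=> s /hB.1[].
rewrite derive1_id.
have t01' : in01 t by move: t01; rewrite /in01; lra.
by have [] := (hC.1 t t01').1 _ (derive1_lip01 LA t01 dA).
Qed.

Lemma star_marginl y z : in01 y -> in01 z -> star A B Cf 1 y z = B y z.
Proof.
move=> y01 z01; have [_ LB] := copula2_lip hB z01.
apply: (lip01_RintegralE LB) => //; first by have [] := hB.1 _ z01.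
apply: aeW => t t01 dB.
rewrite (@derive1_eq01 _ (fun s => A 1 s) id)//; last by move=> s /hA.1[].
rewrite derive1_id.
have t01' : in01 t by move: t01; rewrite /in01; lra.
by have [] := (hC.1 t t01').1 _ (derive1_lip01 LB t01 dB).
Qed.
End margins.


(** Inversion is continuous off 0, and the singleton {0} is treated apart. This serves the quotient
    in [interp]. *)
Lemma measurable_invr (R : realType) : measurable_fun setT (@GRing.inv R).
Proof.
have m0 : measurable [set (0 : R)] by exact: measurable_set1.
rewrite -(setUv [set (0 : R)]); apply/measurable_funU => //.
  exact: measurableC.
split; first exact: measurable_fun_set1.
apply: subspace_continuous_measurable_fun; first exact: measurableC.
apply: continuous_in_subspaceT => x; rewrite inE/= => /eqP x0.
exact: inv_continuous.
Qed.

(** * Sklar extension of a subcopula from a countable grid *)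

Section extension.
Variables (R : realType) (d : nat -> R).
Hypothesis d01 : forall n, in01 (d n).
Hypotheses (d0 : range d 0) (d1 : range d 1).
Implicit Types F h : R -> R.

(** On the grid, [h] is a nondecreasing 1-Lipschitz function of the value of [F]; in particular [h]
    is constant wherever [F] is. *)
Definition dominated F h := forall x y, range d x -> range d y -> x <= y ->
  0 <= h y - h x <= F y - F x.

(** Here [dominated F F] just encodes that [F] is nondecreasing on the grid. *)
Definition margin F := [/\ F 0 = 0, F 1 = 1 & dominated F F].

(* [(bracket F u n).1 <= (bracket F u n).2] are the points of [{0, 1, d 0, .., d (n-1)}]
   between whose [F]-values [u] lies; they nest as [n] grows, also when [u] sits in
   a jump of [F]. *)
Fixpoint bracket F u n : R * R :=
  if n is m.+1 then
    if F (d m) <= u then (Num.max (bracket F u m).1 (d m), (bracket F u m).2)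
    else ((bracket F u m).1, Num.min (bracket F u m).2 (d m))
  else (0, 1).

(* When the two [F]-values agree the quotient is [x / 0 = 0], and the value is [h lr.1]. *)
Definition interp F h u (lr : R * R) :=
  h lr.1 + (h lr.2 - h lr.1) * ((u - F lr.1) / (F lr.2 - F lr.1)).

(** The interpolant through the points [(F x, h x)], built as a limit of finite stages so that
    measurability in a parameter is inherited. *)
Definition extend F h u := lim (interp F h u (bracket F u n) @[n --> \oo]).

Lemma bracket_range F u n :
  range d (bracket F u n).1 /\ range d (bracket F u n).2.
Proof.
elim: n => [//|n [IHl IHr]] /=; case: ifP => _ /=; split => //.
  by case: leP => _ //; exists n.
by case: leP => _ //; exists n.
Qed.

Lemma bracket_monoS F u n : (bracket F u n).1 <= (bracket F u n.+1).1 /\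
  (bracket F u n.+1).2 <= (bracket F u n).2.
Proof.
by rewrite /=; case: ifP => _ /=; split => //; rewrite ?le_max ?ge_min lexx.
Qed.

Lemma bracket_mem F u k n : (k < n)%N -> F (d k) <= u ->
  d k <= (bracket F u n).1.
Proof.
move=> + Fk; elim: n => // n IH; rewrite ltnS leq_eqVlt => /predU1P[kn|kn].
  by rewrite /= -kn Fk /= le_max lexx orbT.
by have [+ _] := bracket_monoS F u n; apply: le_trans; exact: IH.
Qed.

Section fixed_margin.
Variable F : R -> R.
Hypothesis FM : margin F.

Let Fd : dominated F F. Proof. by case: FM. Qed.

Let range01 x : range d x -> in01 x.
Proof. by move=> [n _ <-]. Qed.

Lemma bracketP u n : in01 u ->
  [/\ F (bracket F u n).1 <= u, u <= F (bracket F u n).2 &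
      (bracket F u n).1 <= (bracket F u n).2].
Proof.
move=> u01; have [F0 F1 _] := FM.
(* The strict inequality on the right is what rules out crossed endpoints: [r <= l] would give
   [F r <= F l <= u < F r]. The alternative covers the initial endpoint 1, needed when [u = 1]. *)
have [] : F (bracket F u n).1 <= u /\
    (u < F (bracket F u n).2 \/ (bracket F u n).2 = 1).
  elim: n => [|n [IHl IHr]] /=; first by rewrite F0; case/andP: u01; auto.
  case: (leP (F (d n)) u) => Fdu /=; split => //.
    by case: (leP (bracket F u n).1).
  by case: (leP (bracket F u n).2) => _; [exact: IHr|left].
have [lD rD] := bracket_range F u n.
move=> Fl [ur|r1]; split => //.
- exact: ltW.
- rewrite leNgt; apply/negP => /ltW rl.
  have := Fd rD lD rl; lra.
- by rewrite r1 F1; case/andP: u01.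
- by rewrite r1; case/andP: (range01 lD).
Qed.

(** The brackets coincide until a grid point has its [F]-value in ]u,v]; that point becomes a
    barrier between them, and nesting preserves the separation. *)
Lemma bracket_cmp u v n : u <= v -> bracket F u n = bracket F v n \/
  (bracket F u n).2 <= (bracket F v n).1.
Proof.
move=> uv; elim: n => [|n IH]; first by left.
have [_ ru] := bracket_monoS F u n; have [lv _] := bracket_monoS F v n.
case: IH => [E|lr]; last by right; rewrite (le_trans ru) ?(le_trans lr).
rewrite /= E; case: (leP (F (d n)) u) => Fu.
  by rewrite (le_trans Fu uv); left.
case: (leP (F (d n)) v) => Fv; last by left.
by right; rewrite /= ge_min !le_max lexx !orbT.
Qed.

Section fixed_function.
Variable h : R -> R.
Hypothesis hd : dominated F h.

Let frac01 (a b u : R) : a <= u <= b -> 0 <= (u - a) / (b - a) <= 1.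
Proof.
move=> /andP[au ub]; rewrite divr_ge0 ?subr_ge0//; last exact: le_trans ub.
have [ba|ba] := leP b a; last by rewrite ler_pdivrMr ?subr_gt0// mul1r; lra.
by rewrite (_ : b - a = 0) ?invr0 ?mulr0; lra.
Qed.

Lemma interp_bounds u n : in01 u ->
  h (bracket F u n).1 <= interp F h u (bracket F u n) /\
  interp F h u (bracket F u n) <= h (bracket F u n).2.
Proof.
move=> u01; have [Fl Fr lr] := bracketP n u01.
have [lD rD] := bracket_range F u n.
have /andP[c0 c1] : 0 <= (u - F (bracket F u n).1) /
  (F (bracket F u n).2 - F (bracket F u n).1) <= 1 by apply: frac01; rewrite Fl.
have /andP[h0 _] := hd lD rD lr; rewrite /interp; split; first by nra.
by nra.
Qed.

Lemma interp_homo u v n : in01 u -> in01 v -> u <= v ->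
  interp F h u (bracket F u n) <= interp F h v (bracket F v n).
Proof.
move=> u01 v01 uv; have [_ ub] := interp_bounds n u01.
have [vb _] := interp_bounds n v01.
have [E|rl] := bracket_cmp n uv.
  have [_ _ lr] := bracketP n u01; have [lD rD] := bracket_range F u n.
  have /andP[h0 hF] := hd lD rD lr.
  rewrite /interp -E lerD2l ler_wpM2l// ler_wpM2r ?invr_ge0; lra.
apply: (le_trans ub); apply: le_trans vb.
have [_ rD] := bracket_range F u n; have [lD _] := bracket_range F v n.
by have /andP[] := hd rD lD rl; rewrite subr_ge0.
Qed.

Lemma bracket_is_cvg u : in01 u ->
  cvgn (fun n => h (bracket F u n).1) /\ cvgn (fun n => h (bracket F u n).2).
Proof.
move=> u01; split.
  apply: nondecreasing_is_cvgn.
    apply/nondecreasing_seqP => n.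
    have [lD _] := bracket_range F u n; have [lD' _] := bracket_range F u n.+1.
    have [l _] := bracket_monoS F u n.
    by have /andP[] := hd lD lD' l; rewrite subr_ge0.
  exists (h 1) => _ [n _ <-]; have [lD _] := bracket_range F u n.
  have l1 : (bracket F u n).1 <= 1 by case/andP: (range01 lD).
  by have /andP[] := hd lD d1 l1; rewrite subr_ge0.
apply: nonincreasing_is_cvgn.
  apply/nonincreasing_seqP => n.
  have [_ lD] := bracket_range F u n; have [_ lD'] := bracket_range F u n.+1.
  have [_ l] := bracket_monoS F u n.
  by have /andP[] := hd lD' lD l; rewrite subr_ge0.
exists (h 0) => _ [n _ <-]; have [_ rD] := bracket_range F u n.
have r0 : 0 <= (bracket F u n).2 by case/andP: (range01 rD).
by have /andP[] := hd d0 rD r0; rewrite subr_ge0.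
Qed.

End fixed_function.

(** The endpoint values converge by monotonicity. If the gap in [F] has a nonzero limit, the
    quotient converges too; if the gap tends to 0, domination squeezes the interpolant onto the
    limit of the left values. *)
Lemma interp_is_cvg h u : dominated F h -> in01 u ->
  cvgn (fun n => interp F h u (bracket F u n)).
Proof.
move=> hd u01; have [cl cr] := bracket_is_cvg hd u01.
have [cFl cFr] := bracket_is_cvg Fd u01.
have cFB : cvgn (fun n => F (bracket F u n).2 - F (bracket F u n).1).
  exact: is_cvgB.
have [lim0|lim_neq0] := eqVneq
  (limn (fun n => F (bracket F u n).2 - F (bracket F u n).1)) 0; last first.
  apply: is_cvgD => //; apply: is_cvgM; first exact: is_cvgB.
  apply: is_cvgM; first by apply: is_cvgB => //; exact: is_cvg_cst.
  exact: is_cvgV.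
apply: (cvgP (limn (fun n => h (bracket F u n).1))).
apply: (squeeze_cvgr (f := fun n => h (bracket F u n).1)
  (h := fun n => h (bracket F u n).1 + (F (bracket F u n).2 - F (bracket F u n).1))) => //.
  apply: nearW => n; have [il ir] := interp_bounds hd n u01.
  rewrite il/=; apply: (le_trans ir).
  have [_ _ lr] := bracketP n u01; have [lD rD] := bracket_range F u n.
  by have /andP[_] := hd _ _ lD rD lr; lra.
rewrite -[X in _ --> X]addr0 -lim0; exact: cvgD.
Qed.

Lemma eq_extend h k u : (forall x, range d x -> h x = k x) ->
  extend F h u = extend F k u.
Proof.
move=> hk; rewrite /extend; congr (limn _); apply/funext => n; rewrite /interp.
by have [/hk -> /hk ->] := bracket_range F u n.
Qed.

(** Brackets and weights depend on [F] and [u] only, so every stage is linear in [h]. *)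
Lemma extendB h k u : dominated F h -> dominated F k -> in01 u ->
  extend F (fun x => h x - k x) u = extend F h u - extend F k u.
Proof.
move=> hd kd u01; rewrite /extend -limB; [|exact: interp_is_cvg..].
congr (limn _); apply/funext => n; rewrite !fctE /interp.
set c := (_ / _); ring.
Qed.

Lemma extend_homo h u v : dominated F h -> in01 u -> in01 v -> u <= v ->
  extend F h u <= extend F h v.
Proof.
move=> hd u01 v01 uv; apply: ler_lim; [exact: interp_is_cvg..|].
by apply: nearW => n; exact: interp_homo.
Qed.

(** Once [d k] has been inspected, the left endpoint is at least [d k] with the same [F]-value, so
    domination forces the same [h]-value and the sequence is constant. *)
Lemma extend_range h x : dominated F h -> range d x -> extend F h (F x) = h x.
Proof.
move=> hd [k _ <-]; apply: lim_near_cst => //; exists k.+1 => // n /= kn.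
have dD : range d (d k) by exists k.
have F01 : in01 (F (d k)).
  have [F0 F1 _] := FM; have /andP[k0 k1] := d01 k.
  have := Fd d0 dD k0; have := Fd dD d1 k1; rewrite /in01 F0 F1; lra.
have [lD _] := bracket_range F (F (d k)) n.
have [Fl _ _] := bracketP n F01.
have kl := bracket_mem kn (lexx (F (d k))).
have /andP[hk1 hk2] := hd _ _ dD lD kl; have /andP[Fk _] := Fd dD lD kl.
have FE : F (bracket F (F (d k)) n).1 = F (d k) by lra.
rewrite /interp FE subrr mul0r mulr0 addr0; lra.
Qed.

Lemma extend_id u : in01 u -> extend F F u = u.
Proof.
move=> u01; apply: lim_near_cst => //; apply: nearW => n; rewrite /interp.
have [Fl Fr _] := bracketP n u01.
have [E|NE] := eqVneq (F (bracket F u n).2 - F (bracket F u n).1) 0.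
  by rewrite E mul0r addr0; lra.
by rewrite mulrC divfK// addrC subrK.
Qed.

Lemma extend0 u : extend F (fun=> 0) u = 0.
Proof.
by apply: lim_near_cst => //; apply: nearW => n; rewrite /interp subrr mul0r addr0.
Qed.

End fixed_margin.

(** A joint distribution function on the grid with arbitrary margins [H ^~ 1] and [H 1]; it is a
    subcopula in the usual sense when read as a function of these margins. *)
Definition subcopula (H : R -> R -> R) :=
  [/\ forall x, range d x -> H x 0 = 0 /\ H 0 x = 0, H 1 1 = 1 &
      forall x x' z z', range d x -> range d x' -> range d z -> range d z' ->
        x <= x' -> z <= z' -> 0 <= H x' z' - H x' z - H x z' + H x z].

(* Linearity and monotonicity of [extend] in its second argument make the iterated
   extension 2-increasing. *)
Definition sklar (H : R -> R -> R) u v :=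
  extend (H ^~ 1) (fun x => extend (H 1) (H x) v) u.

Section sklar.
Variable H : R -> R -> R.
Hypothesis HS : subcopula H.

Let F := H ^~ 1.
Let G := H 1.

Let ge0d x : range d x -> 0 <= x. Proof. by move=> [n _ <-]; case/andP: (d01 n). Qed.
Let le1d x : range d x -> x <= 1. Proof. by move=> [n _ <-]; case/andP: (d01 n). Qed.

(** The masses of the strips over [0,x], [x,x'] and [x',1] are nonnegative and add up to the
    increment of [G]. *)
Let H_dom x x' : range d x -> range d x' -> x <= x' ->
  dominated G (fun z => H x' z - H x z).
Proof.
move=> xD xD' xx' z z' zD zD' zz'; have [H0 _ H2] := HS; rewrite /G.
have := H2 _ _ _ _ xD xD' zD zD' xx' zz'.
have := H2 _ _ _ _ d0 xD zD zD' (ge0d xD) zz'.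
have := H2 _ _ _ _ xD' d1 zD zD' (le1d xD') zz'.
have [_ ->] := H0 _ zD; have [_ ->] := H0 _ zD'.
by move=> *; apply/andP; split; lra.
Qed.

Let Hx_dom x : range d x -> dominated G (H x).
Proof.
move=> xD z z' zD zD' zz'; have [H0 _ _] := HS.
have := H_dom d0 xD (ge0d xD) zD zD' zz'.
have [_ ->] := H0 _ zD; have [_ ->] := H0 _ zD'; lra.
Qed.

Let GM : margin G.
Proof.
have [H0 H11 _] := HS; split => //; first by have [] := H0 _ d1.
exact: Hx_dom.
Qed.

Let Hz_dom z z' : range d z -> range d z' -> z <= z' ->
  dominated F (fun x => H x z' - H x z).
Proof.
move=> zD zD' zz' x x' xD xD' xx'; have [H0 _ H2] := HS; rewrite /F.
have := H2 _ _ _ _ xD xD' zD zD' xx' zz'.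
have := H2 _ _ _ _ xD xD' d0 zD xx' (ge0d zD).
have := H2 _ _ _ _ xD xD' zD' d1 xx' (le1d zD').
have [-> _] := H0 _ xD; have [-> _] := H0 _ xD'.
by move=> *; apply/andP; split; lra.
Qed.

Let FM : margin F.
Proof.
have [H0 H11 _] := HS; split => //; first by have [] := H0 _ d1.
move=> x x' xD xD' xx'.
have := Hz_dom d0 d1 ler01 xD xD' xx'; rewrite /F.
have [-> _] := H0 _ xD; have [-> _] := H0 _ xD'; lra.
Qed.

Let K v x := extend G (H x) v.

Let K0 x : range d x -> K 0 x = 0.
Proof.
move=> xD; have [H0 _ _] := HS; have [G0 _ _] := GM.
rewrite /K -[X in extend _ _ X]G0 (extend_range GM (Hx_dom xD) d0).
by have [] := H0 _ xD.
Qed.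

Let K1 x : range d x -> K 1 x = F x.
Proof.
move=> xD; have [_ G1 _] := GM.
by rewrite /K -[X in extend _ _ X]G1 (extend_range GM (Hx_dom xD) d1).
Qed.

Let KB v x x' : in01 v -> range d x -> range d x' ->
  K v x' - K v x = extend G (fun z => H x' z - H x z) v.
Proof. by move=> v01 xD xD'; rewrite (extendB GM)//; exact: Hx_dom. Qed.

Let K_2inc v v' x x' : in01 v -> in01 v' -> v <= v' ->
  range d x -> range d x' -> x <= x' ->
  K v x' - K v x <= K v' x' - K v' x.
Proof.
move=> v01 v01' vv' xD xD' xx'; rewrite !KB//.
by apply: (extend_homo GM) => //; exact: H_dom.
Qed.

Let K_dom v : in01 v -> dominated F (K v).
Proof.
move=> v01 x x' xD xD' xx'; have /andP[v0 v1] := v01.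
have := K_2inc (in01_0 R) v01 v0 xD xD' xx'.
have := K_2inc v01 (in01_1 R) v1 xD xD' xx'.
by rewrite !K0// !K1// subrr => *; apply/andP.
Qed.

Let KK_dom v v' : in01 v -> in01 v' -> v <= v' ->
  dominated F (fun x => K v' x - K v x).
Proof.
move=> v01 v01' vv' x x' xD xD' xx'.
have := K_2inc v01 v01' vv' xD xD' xx'.
have := K_dom v01 xD xD' xx'; have := K_dom v01' xD xD' xx'; lra.
Qed.

Lemma subcopula_margin :
  [/\ margin (H ^~ 1), margin (H 1),
      forall x, range d x -> dominated (H 1) (H x) &
      forall v, in01 v -> dominated (H ^~ 1) (fun x => extend (H 1) (H x) v)].
Proof. by split; [exact: FM|exact: GM|exact: Hx_dom|exact: K_dom]. Qed.

Lemma sklar_range x z : range d x -> range d z -> sklar H (H x 1) (H 1 z) = H x z.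
Proof.
move=> xD zD; have G01 : in01 (H 1 z).
  have [G0 G1 Gd] := GM.
  have := Gd _ _ d0 zD (ge0d zD); have := Gd _ _ zD d1 (le1d zD).
  by rewrite G0 G1 /in01 /G; lra.
rewrite /sklar (extend_range FM (K_dom G01) xD).
exact: (extend_range GM (Hx_dom xD) zD).
Qed.

Lemma sklar_copula2 : is_copula2 (sklar H).
Proof.
have [H0 _ _] := HS; have [F0 F1 _] := FM; have [G0 G1 _] := GM.
split=> [u u01|u u' v v' u01 u01' v01 v01' uu' vv'].
  split.
  - by rewrite -[RHS](extend0 F u); apply: eq_extend => x /K0.
  - rewrite /sklar -[X in extend _ _ X]F0 (extend_range FM (K_dom u01) d0).
    rewrite -[RHS](extend0 G u); apply: eq_extend => z /H0[].
    by [].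
  - by rewrite -[RHS](extend_id FM u01); apply: eq_extend => x /K1.
  - rewrite /sklar -[X in extend _ _ X]F1 (extend_range FM (K_dom u01) d1).
    exact: extend_id.
have := extend_homo FM (KK_dom v01 v01' vv') u01 u01' uu'.
rewrite !(extendB FM)//; try exact: K_dom.
by rewrite /sklar -/F -/G /K; lra.
Qed.

End sklar.

(** * Measurable dependence of the extension on a parameter *)

Section measurability.
Context (disp : measure_display) (T : measurableType disp).

(** Each stage is a finite case distinction on the tests [F t (d m) <= u]. Quantifying over [g] lets
    the induction absorb the last test into [g']. *)
Let measurable_bracket (F : T -> R -> R) (g : T -> R * R -> R) u n :
  (forall x, range d x -> measurable_fun setT (F ^~ x)) ->
  (forall l r, range d l -> range d r -> measurable_fun setT (g ^~ (l, r))) ->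
  measurable_fun setT (fun t => g t (bracket (F t) u n)).
Proof.
move=> mF; elim: n g => [|n IH] g mg /=; first exact: mg.
pose g' t (lr : R * R) := if F t (d n) <= u then g t (Num.max lr.1 (d n), lr.2)
  else g t (lr.1, Num.min lr.2 (d n)).
rewrite [X in measurable_fun _ X](_ : _ =
    fun t => g' t (bracket (F t) u n)); last first.
  by apply/funext => t; rewrite /g'; case: ifP.
have dD : range d (d n) by exists n.
apply: IH => l r lD rD; apply: measurable_fun_ifT.
- by apply: measurable_fun_ler => //; exact: mF.
- by apply: mg => //=; case: leP.
- by apply: mg => //=; case: leP.
Qed.

Lemma measurable_extend (F h : T -> R -> R) u : in01 u ->
  (forall t, margin (F t)) -> (forall t, dominated (F t) (h t)) ->
  (forall x, range d x -> measurable_fun setT (F ^~ x)) ->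
  (forall x, range d x -> measurable_fun setT (h ^~ x)) ->
  measurable_fun setT (fun t => extend (F t) (h t) u).
Proof.
move=> u01 FM hd mF mh.
apply: (@measurable_fun_cvg _ _ _ _
  (fun n t => interp (F t) (h t) u (bracket (F t) u n))).
  move=> n; apply: (@measurable_bracket F (fun t => interp (F t) (h t) u)) => //.
  move=> l r lD rD; rewrite /interp/=.
  apply: measurable_funD; first exact: mh.
  apply: measurable_funM; first by apply: measurable_funB; exact: mh.
  apply: measurable_funM; first by apply: measurable_funB => //; exact: mF.
  apply: measurableT_comp; first exact: measurable_invr.
  by apply: measurable_funB; exact: mF.
by move=> t _; exact: interp_is_cvg.
Qed.

Lemma measurable_sklar (H : T -> R -> R -> R) u v : in01 u -> in01 v ->
  (forall t, subcopula (H t)) ->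
  (forall x z, range d x -> range d z -> measurable_fun setT (fun t => H t x z)) ->
  measurable_fun setT (fun t => sklar (H t) u v).
Proof.
move=> u01 v01 HS mH.
apply: (@measurable_extend (fun t => (H t)^~ 1)
  (fun t x => extend (H t 1) (H t x) v)) => //.
- by move=> t; have [] := subcopula_margin (HS t).
- by move=> t; have [_ _ _] := subcopula_margin (HS t); exact.
- by move=> x xD; exact: mH.
move=> x xD; apply: (@measurable_extend (fun t => H t 1) (fun t => H t x)) => //.
- by move=> t; have [] := subcopula_margin (HS t).
- by move=> t; have [_ _ + _] := subcopula_margin (HS t); exact.
- by move=> z zD; exact: mH.
- by move=> z zD; exact: mH.
Qed.

End measurability.

End extension.


(** * A countable dense grid in the unit interval *)

Section dense01.
Variable R : realType.

(** Clamping and the default 0 make the enumeration total with values in [0,1], as the grid [d] of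
    the extension must be. *)
Definition rat01 (n : nat) : R := clamp01 (ratr (odflt 0%R (unpickle n : option rat))).

Lemma rat01_in n : in01 (rat01 n).
Proof. exact: clamp01_in. Qed.

Let rat01_range (q : rat) : in01 (ratr q : R) -> range rat01 (ratr q).
Proof.
by move=> q01; exists (pickle q) => //; rewrite /rat01 pickleK/= clamp01_id.
Qed.

Lemma rat01_0 : range rat01 0.
Proof. by have := @rat01_range 0%R; rewrite rmorph0; apply. Qed.

Lemma rat01_1 : range rat01 1.
Proof. by have := @rat01_range 1%R; rewrite rmorph1; apply. Qed.

(** Approximation is from above, so that the increments from [x] to its approximant are
    nonnegative. *)
Lemma rat01_dense (x e : R) : in01 x -> 0 < e ->
  exists2 y, range rat01 y & x <= y <= x + e.
Proof.
move=> /andP[x0 x1] e0; have [x1'|x1'] := leP 1 x.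
  by exists 1; [exact: rat01_1|lra].
have xm : x < Num.min 1 (x + e) by rewrite lt_min x1'/= ltrDl.
have [q] := rat_in_itvoo xm; rewrite in_itv/= lt_min => /and3P[xq q1 qe].
exists (ratr q); last by lra.
by apply: rat01_range; rewrite /in01; lra.
Qed.

End dense01.
#[local] Hint Resolve rat01_0 rat01_1 rat01_in : core.

(** This turns linear inequalities between increments in the middle variable into inequalities
    between derivatives. *)
Lemma is_derive_le (R : realType) (F G : R -> R) (a b t : R) : 0 < t < 1 ->
  is_derive t 1 F a -> is_derive t 1 G b ->
  (forall s r, in01 s -> in01 r -> s <= r -> G s - F s <= G r - F r) -> a <= b.
Proof.
move=> t01 dF dG GF; have dGF := is_deriveB dG dF.
rewrite -subr_ge0.
have <- : derive1 (G - F) t = b - a by rewrite derive1E; exact: derive_val.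
by apply: derive_ge0_of_homo => //; exact: ex_derive.
Qed.

Lemma is_derive_eq01 (R : realType) (F G : R -> R) (a b t : R) : 0 < t < 1 ->
  is_derive t 1 F a -> is_derive t 1 G b -> (forall s, in01 s -> F s = G s) ->
  a = b.
Proof.
move=> t01 dF dG FG; apply/eqP; rewrite eq_le; apply/andP; split.
  by apply: (is_derive_le t01 dF dG) => s r s01 r01 _; rewrite !FG ?subrr.
by apply: (is_derive_le t01 dG dF) => s r s01 r01 _; rewrite !FG ?subrr.
Qed.

Lemma derivable_is_derive1 (R : realType) (F : R -> R) (t : R) :
  derivable F t 1 -> is_derive t 1 F (derive1 F t).
Proof. by move=> dF; rewrite derive1E; exact: DeriveDef. Qed.

(** * Disintegration of a 3-copula along its middle coordinate *)

Section star_representation.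
Variables (R : realType) (K : R -> R -> R -> R).
Hypothesis hK : is_copula3 K.

Local Notation mu := (@lebesgue_measure R).
Local Notation D := (range (@rat01 R)).

Let D01 x : D x -> in01 x. Proof. by move=> [n _ <-]. Qed.

(** The 3-increasing inequality is regrouped as monotonicity in the middle variable of the mass of a
    rectangle, the form that [is_derive_le] consumes. *)
Let K_box a b s r c e : in01 a -> in01 b -> in01 s -> in01 r -> in01 c -> in01 e ->
  a <= b -> s <= r -> c <= e ->
  K b s e - K a s e - K b s c + K a s c <= K b r e - K a r e - K b r c + K a r c.
Proof.
by case: hK => _ _ H a01 b01 s01 r01 c01 e01 ab sr ce;
  have := H _ _ _ _ _ _ a01 b01 s01 r01 c01 e01 ab sr ce; lra.
Qed.

Let K00 x s : in01 x -> in01 s -> [/\ K 0 s x = 0, K x 0 s = 0 & K x s 0 = 0].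
Proof.
move=> x01 s01; have [H _ _] := hK.
have [-> _ _] := H s x s01 x01; have [_ -> _] := H x s x01 s01.
by have [_ _ ->] := H x s x01 s01.
Qed.

Let K11 s : in01 s -> K 1 s 1 = s.
Proof. by case: hK => _ H _ /H[]. Qed.

Let K_slice a b s r z : in01 a -> in01 b -> in01 s -> in01 r -> in01 z ->
  a <= b -> s <= r -> K b s z - K a s z <= K b r z - K a r z.
Proof.
move=> a01 b01 s01 r01 z01 ab sr.
have z0 : 0 <= z by case/andP: z01.
have := K_box a01 b01 s01 r01 (in01_0 R) z01 ab sr z0.
have [_ _ ->] := K00 a01 s01; have [_ _ ->] := K00 b01 s01.
have [_ _ ->] := K00 a01 r01; have [_ _ ->] := K00 b01 r01; lra.
Qed.

Let K_slice' c e s r x : in01 c -> in01 e -> in01 s -> in01 r -> in01 x ->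
  c <= e -> s <= r -> K x s e - K x s c <= K x r e - K x r c.
Proof.
move=> c01 e01 s01 r01 x01 ce sr.
have x0 : 0 <= x by case/andP: x01.
have := K_box (in01_0 R) x01 s01 r01 c01 e01 x0 sr ce.
have [-> _ _] := K00 c01 s01; have [-> _ _] := K00 e01 s01.
have [-> _ _] := K00 c01 r01; have [-> _ _] := K00 e01 r01; lra.
Qed.

Let K_mono s r x z : in01 s -> in01 r -> in01 x -> in01 z -> s <= r ->
  K x s z <= K x r z.
Proof.
move=> s01 r01 x01 z01 sr; have x0 : 0 <= x by case/andP: x01.
have := K_slice (in01_0 R) x01 s01 r01 z01 x0 sr.
have [-> _ _] := K00 z01 s01; have [-> _ _] := K00 z01 r01; lra.
Qed.

Let K_lip x z : in01 x -> in01 z -> lip01 (fun s => K x s z).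
Proof.
move=> x01 z01 s r s01 r01 sr.
have := K_mono s01 r01 x01 z01 sr.
have := K_slice x01 (in01_1 R) s01 r01 (in01_1 R) (proj2 (andP x01)) sr.
have := K_slice' z01 (in01_1 R) s01 r01 x01 (proj2 (andP z01)) sr.
by rewrite !K11// => *; apply/andP; split; lra.
Qed.

(** Pairs outside the unit square get the zero density, which makes measurability unconditional
    before [choice] is applied. *)
Let densities : exists f : R -> R -> R -> R, forall x z,
  measurable_fun setT (f x z) /\ (in01 x -> in01 z ->
  [/\ {ae mu, forall t : R, 0 < t < 1 -> is_derive t 1 (fun s => K x s z) (f x z t)} &
      forall y, in01 y -> (\int[mu]_(t in `[0%R, y]) (f x z t)%:E = (K x y z)%:E)%E]).
Proof.
have ? := aeleb_filter R.
have H (p : R * R) : exists f : R -> R, measurable_fun setT f /\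
    (in01 p.1 -> in01 p.2 ->
    [/\ {ae mu, forall t : R, 0 < t < 1 -> is_derive t 1 (fun s => K p.1 s p.2) (f t)} &
    forall y, in01 y -> (\int[mu]_(t in `[0%R, y]) (f t)%:E = (K p.1 y p.2)%:E)%E]).
  have [[x01 z01]|np] := pselect (in01 p.1 /\ in01 p.2); last first.
    by exists (cst 0); split; [exact: measurable_cst|move=> *; exfalso; apply: np].
  have [f [mf _ df If]] := lip01_density (K_lip x01 z01).
  exists f; split => // _ _; split.
    by apply: filterS df => t dft /dft[dF <-]; exact: derivable_is_derive1.
  by move=> y /If ->; have [_ -> _] := K00 x01 z01; rewrite subr0.
have [f fP] := choice H.
by exists (fun x z => f (x, z)) => x z; exact: (fP (x, z)).
Qed.

Variables A B : R -> R -> R.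
Hypothesis KA : forall x t, in01 x -> in01 t -> K x t 1 = A x t.
Hypothesis KB : forall t z, in01 t -> in01 z -> K 1 t z = B t z.

(** Stated for a generic 3-copula [K], so that each coordinate of [Ct] can take the middle place in
    turn. *)
Lemma star_representation : exists2 Cf, copula_family Cf &
  forall x y z, in01 x -> in01 y -> in01 z -> K x y z = star A B Cf x y z.
Proof.
have ? := aeleb_filter R.
have [f fP] := densities.
have mf x z : measurable_fun setT (f x z) by have [] := fP x z.
have df x z : in01 x -> in01 z -> {ae mu, forall t : R, 0 < t < 1 ->
    is_derive t 1 (fun s => K x s z) (f x z t)}.
  by move=> x01 z01; have [_ /(_ x01 z01)[]] := fP x z.
(* Countability of the grid gives one null set [N] that serves all pairs of grid points. *)
have [N [mN N0 goodN]] : {ae mu, forall (t : R) i j, 0 < t < 1 ->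
    is_derive t 1 (fun s => K (rat01 R i) s (rat01 R j))
      (f (rat01 R i) (rat01 R j) t)}.
  by apply/ae_foralln => i; apply/ae_foralln => j; exact: df.
have fD t x z : 0 < t < 1 -> ~ N t -> D x -> D z ->
    is_derive t 1 (fun s => K x s z) (f x z t).
  move=> t01 Nt [i _ <-] [j _ <-]; move: t01; apply: contrapT => h.
  by apply: Nt; apply: goodN => /= good; exact: (h (good i j)).
pose A0 : set R := `]0, 1[%classic `\` N.
have mA0 : measurable A0 by apply: measurableD.
(* The product copula fills in at the exceptional [t], so that [H t] is a subcopula for every
   [t]. *)
pose H t x z := if t \in A0 then f x z t else x * z.
have A0P t : t \in A0 -> 0 < t < 1 /\ ~ N t.
  by rewrite inE => -[]; rewrite /= in_itv.
have HS t : subcopula (@rat01 R) (H t).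
  rewrite /H; case: (boolP (t \in A0)) => [/A0P[t01 Nt]|_]; last first.
    split => [x xD||x x' z z' xD xD' zD zD' xx' zz']; rewrite ?mulr0 ?mul0r ?mulr1//.
    rewrite (_ : _ + _ = (x' - x) * (z' - z)); last by ring.
    by rewrite mulr_ge0// subr_ge0.
  have t01' : in01 t by rewrite /in01; lra.
  split.
  - move=> x xD; have x01 := D01 xD; have d := is_derive_cst (0:R) t (1:R).
    split.
      apply: (is_derive_eq01 t01 (fD _ _ _ t01 Nt xD (rat01_0 R)) d) => s s01.
      by have [] := K00 x01 s01.
    apply: (is_derive_eq01 t01 (fD _ _ _ t01 Nt (rat01_0 R) xD) d) => s s01.
    by have [] := K00 x01 s01.
  - apply: (is_derive_eq01 t01 (fD _ _ _ t01 Nt (rat01_1 R) (rat01_1 R))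
      (is_derive_id t (1:R))) => s; exact: K11.
  - move=> x x' z z' xD xD' zD zD' xx' zz'.
    suff : f x' z t + f x z' t <= f x' z' t + f x z t by lra.
    apply: (is_derive_le t01
      (is_deriveD (fD _ _ _ t01 Nt xD' zD) (fD _ _ _ t01 Nt xD zD'))
      (is_deriveD (fD _ _ _ t01 Nt xD' zD') (fD _ _ _ t01 Nt xD zD))) => s r s01 r01 sr.
    have := K_box (D01 xD) (D01 xD') s01 r01 (D01 zD) (D01 zD') xx' sr zz'.
    by rewrite !fctE; lra.
have HM t := subcopula_margin (@rat01_in R) (rat01_0 R) (rat01_1 R) (HS t).
(* [copula_family] asks for measurability at all real [u], [v], whereas [sklar] is controlled on the
   unit square only; hence the clamping. *)
pose Cf t u v := sklar (@rat01 R) (H t) (clamp01 u) (clamp01 v).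
have CfE t u v : in01 u -> in01 v -> Cf t u v = sklar (@rat01 R) (H t) u v.
  by move=> u01 v01; rewrite /Cf !clamp01_id.
have Cf2 t : is_copula2 (Cf t).
  have [S1 S2] := sklar_copula2 (@rat01_in R) (rat01_0 R) (rat01_1 R) (HS t).
  split=> [u u01|u1 u2 v1 v2 u11 u21 v11 v21]; last by rewrite !CfE//; exact: S2.
  by have [? ? ? ?] := S1 u u01; rewrite !CfE.
exists Cf.
  split=> // u v; apply: measurable_funTS.
  apply: (measurable_sklar (@rat01_in R) (rat01_0 R) (rat01_1 R)) => //;
    try exact: clamp01_in.
  move=> x z xD zD; rewrite /H; apply: measurable_fun_ifT => //.
  apply: (measurable_fun_bool true).
  rewrite setTI (_ : _ @^-1` _ = A0)//.
  by apply/seteqP; split => t /= => [/set_mem|/mem_set].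
move=> x y z x01 y01 z01.
have dA : {ae mu, forall t : R, 0 < t < 1 -> derive1 (fun s => A x s) t = f x 1 t}.
  have := df _ _ x01 (in01_1 R); apply: filterS => t dKt t01.
  rewrite (@derive1_eq01 _ _ (fun s => K x s 1) _ t01).
    by have [_] := dKt t01; rewrite derive1E.
  by move=> s s01; rewrite KA.
have dB : {ae mu, forall t : R, 0 < t < 1 -> derive1 (fun s => B s z) t = f 1 z t}.
  have := df _ _ (in01_1 R) z01; apply: filterS => t dKt t01.
  rewrite (@derive1_eq01 _ _ (fun s => K 1 s z) _ t01).
    by have [_] := dKt t01; rewrite derive1E.
  by move=> s s01; rewrite KB.
suff Hphi : {ae mu, forall t : R, in01 t ->
    Cf t (derive1 (fun s => A x s) t) (derive1 (fun s => B s z) t) - f x z t = 0}.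
  have [_ /(_ x01 z01)[_ If]] := fP x z.
  rewrite /star /Rintegral -[LHS]/(fine (K x y z)%:E) -If//.
  congr fine; apply: ae_eq_integral_nomeas.
  move: Hphi; apply: filterS => t h /=; rewrite in_itv/= => ty.
  apply/esym; congr EFin; apply/eqP; rewrite -subr_eq0 h//.
  by move: ty y01; rewrite /in01; lra.
suff : {ae mu, forall t : R, `[0%R, 1%R]%classic t ->
    Cf t (derive1 (fun s => A x s) t) (derive1 (fun s => B s z) t) - f x z t = 0}.
  by apply: filterS => t h t01; apply: h; rewrite /= in_itv.
apply: (ae_eq0_of_small_majorant (mu := mu)
  (phi := fun t : R => Cf t (derive1 (fun s => A x s) t)
                         (derive1 (fun s => B s z) t) - f x z t)).
  exact: measurable_itv.
move=> e e0; have e2 : 0 < e / 2 by lra.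
have [x' x'D /andP[xx' x'e]] := rat01_dense x01 e2.
have [z' z'D /andP[zz' z'e]] := rat01_dense z01 e2.
have [x01' z01'] := (D01 x'D, D01 z'D).
(* The sum of the two margin increments is 2-Lipschitz; halving it makes [lip01_density] applicable.
   The majorant is then [2 * g], whose integral is [(x' - x) + (z' - z) <= e]. *)
pose G (s : R) := (K x' s 1 - K x s 1 + (K 1 s z' - K 1 s z)) / 2.
have GL : lip01 G.
  move=> s r s01 r01 sr; rewrite /G.
  have := K_slice x01 x01' s01 r01 (in01_1 R) xx' sr.
  have := K_slice' z01 z01' s01 r01 (in01_1 R) zz' sr.
  have := K_mono s01 r01 x01 (in01_1 R) sr.
  have := K_mono s01 r01 (in01_1 R) z01 sr.
  have /andP[_] := K_lip x01' (in01_1 R) s01 r01 sr.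
  have /andP[_] := K_lip (in01_1 R) z01' s01 r01 sr.
  by move=> *; apply/andP; split; lra.
have [g [mg g0 dg Ig]] := lip01_density GL.
exists (fun t => 2 * g t); split.
- by apply: measurable_funTS; apply: measurable_funM.
- by move=> t _; rewrite mulr_ge0.
- under eq_integral do rewrite EFinM.
  rewrite ge0_integralZl_EFin//; first last.
  + by apply/measurable_EFinP/measurable_funTS.
  + by move=> t _; rewrite lee_fin.
  rewrite (Ig 1 (in01_1 R)) -EFinM lee_fin /G.
  have [_ H1 _] := hK; have [_ -> _] := K00 x01 (in01_1 R).
  have [_ -> _] := K00 x01' (in01_1 R).
  have [_ K0z _] := K00 (in01_1 R) z01; have [_ K0z' _] := K00 (in01_1 R) z01'.
  have [-> _ _] := H1 _ x01; have [-> _ _] := H1 _ x01'.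
  have [_ _ ->] := H1 _ z01; have [_ _ ->] := H1 _ z01'.
  by rewrite K0z K0z'; lra.
suff : {ae mu, forall t : R, in01 t -> `|Cf t (derive1 (fun s => A x s) t)
    (derive1 (fun s => B s z) t) - f x z t| <= 2 * g t}.
  by apply: filterS => t h; rewrite /= in_itv; exact: h.
apply: ae_interior01.
have goodD : {ae mu, forall t : R, ~ N t}.
  by exists N; split => // t /= /contrapT.
have aeI := @filterI _ _ (aeleb_filter R).
have ae_all := aeI _ _ dA (aeI _ _ dB (aeI _ _ dg (aeI _ _ (df _ _ x01 z01)
  (aeI _ _ (df _ _ x01 (in01_1 R)) (aeI _ _ (df _ _ (in01_1 R) z01) goodD))))).
apply: (@filterS _ _ (aeleb_filter R) _ _ _ ae_all) => t [+ [+ [+ [+ [+ [+ Nt]]]]]] t01.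
move=> /(_ t01)-> /(_ t01)-> /(_ t01)[dG gE] /(_ t01)dw /(_ t01)du /(_ t01)dv.
have {dG}dG : is_derive t 1 G (g t) by rewrite -gE; exact: derivable_is_derive1.
have du' := fD _ _ _ t01 Nt x'D (rat01_1 R).
have dv' := fD _ _ _ t01 Nt (rat01_1 R) z'D.
have dw' := fD _ _ _ t01 Nt x'D z'D.
have f01 a c : in01 a -> in01 c -> is_derive t 1 (fun s => K a s c) (f a c t) ->
    in01 (f a c t).
  move=> a01 c01 dac; apply/andP; split.
    apply: (is_derive_le t01 (is_derive_cst (0:R) t (1:R)) dac) => s r s01 r01 sr.
    by have := K_mono s01 r01 a01 c01 sr; rewrite /cst; lra.
  apply: (is_derive_le t01 dac (is_derive_id t (1:R))) => s r s01 r01 sr.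
  by have /andP[_] := K_lip a01 c01 s01 r01 sr; lra.
have uu' : f x 1 t <= f x' 1 t.
  apply: (is_derive_le t01 du du') => s r s01 r01 sr.
  exact: K_slice.
have vv' : f 1 z t <= f 1 z' t.
  apply: (is_derive_le t01 dv dv') => s r s01 r01 sr.
  exact: K_slice'.
have ww' : f x z t <= f x' z' t.
  apply: (is_derive_le t01 dw dw') => s r s01 r01 sr.
  have := K_slice x01 x01' s01 r01 z01 xx' sr.
  by have := K_slice' z01 z01' s01 r01 x01' zz' sr; lra.
(* The boxes [x,x'] by [z',1] and [x,1] by [z,z'] bound the growth of the density from [(x, z)] to
   [(x', z')] by the growth of the two margins. *)
have uvw : f x' z' t + (f x 1 t + f 1 z t) <= f x' 1 t + (f 1 z' t + f x z t).
  apply: (is_derive_le t01 (is_deriveD dw' (is_deriveD du dv))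
    (is_deriveD du' (is_deriveD dv' dw))) => s r s01 r01 sr; rewrite !fctE.
  have z1 : z <= 1 by case/andP: z01.
  have x1 : x' <= 1 by case/andP: x01'.
  have z1' : z' <= 1 by case/andP: z01'.
  have := K_box x01 x01' s01 r01 z01' (in01_1 R) xx' sr z1'.
  have x0 : 0 <= x by case/andP: x01.
  have := K_box x01 (in01_1 R) s01 r01 z01 z01' (proj2 (andP x01)) sr zz'; lra.
have uvg : f x' 1 t + f 1 z' t <= g t + (g t + (f x 1 t + f 1 z t)).
  apply: (is_derive_le t01 (is_deriveD du' dv')
    (is_deriveD dG (is_deriveD dG (is_deriveD du dv)))) => s r s01 r01 sr.
  by rewrite !fctE /G; lra.
have [u01 v01] := (f01 _ _ x01 (in01_1 R) du, f01 _ _ (in01_1 R) z01 dv).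
have [u01' v01'] := (f01 _ _ x01' (in01_1 R) du', f01 _ _ (in01_1 R) z01' dv').
have tA0 : t \in A0 by rewrite inE; split; rewrite //= in_itv.
have HE a c : H t a c = f a c t by rewrite /H tA0.
(* The identity is exact at the grid points. Both [Cf t (f x 1 t) (f 1 z t)] and [f x z t] lie below
   this common value by at most the margin growth, itself at most [2 * g t], so they differ by no
   more than that. *)
have Cw' : Cf t (f x' 1 t) (f 1 z' t) = f x' z' t.
  rewrite CfE// -!HE.
  exact: (sklar_range (@rat01_in R) (rat01_0 R) (rat01_1 R) (HS t)).
have /andP[C1 C2] := (copula2_lip (Cf2 t) u01).1 _ _ v01 v01' vv'.
have /andP[C3 C4] := (copula2_lip (Cf2 t) v01').2 _ _ u01 u01' uu'.
rewrite Cw' in C3 C4; rewrite ler_norml; apply/andP; split; lra.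
Qed.
End star_representation.

(** * Prescribed marginals and the three star products *)

Theorem theorem5p2 (R : realType) (C12 C13 C23 : R -> R -> R)
  (h12 : is_copula2 C12) (h13 : is_copula2 C13) (h23 : is_copula2 C23)
  (hcomp : compatible C12 C13 C23)
  (Ct : R -> R -> R -> R) (hCt : is_copula3 Ct) :
  has_marginals Ct C12 C13 C23 <->
  exists C1 C2 C3 : R -> R -> R -> R,
    [/\ copula_family C1, copula_family C2, copula_family C3 &
      forall u1 u2 u3, in01 u1 -> in01 u2 -> in01 u3 ->
        Ct u1 u2 u3 = star C13 (transp C23) C3 u1 u3 u2 /\
        Ct u1 u2 u3 = star C12 C23 C2 u1 u2 u3 /\
        Ct u1 u2 u3 = star (transp C12) C13 C1 u2 u1 u3].
Proof.
have h21 := transp_copula2 h12; have h32 := transp_copula2 h23.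
split=> [hm|[C1 [C2 [C3 [hC1 hC2 hC3 HC]]]] u1 u2 u3 u1in u2in u3in].
  have [hb hu hi] := hCt.
  (* Permuting arguments preserves 3-copulas; [hCt2] and [hCt1] put the third and the first
     coordinate in the middle. *)
  have hCt2 : is_copula3 (fun x t z => Ct x z t).
    split=> [u v u01 v01|u /hu[]//|a1 b1 a2 b2 a3 b3 a11 b11 a21 b21 a31 b31 ab1 ab2 ab3].
      have [-> _ _] := hb v u v01 u01; have [_ -> ->] := hb u v u01 v01.
      by [].
    have := hi _ _ _ _ _ _ a11 b11 a31 b31 a21 b21 ab1 ab3 ab2; lra.
  have hCt1 : is_copula3 (fun x t z => Ct t x z).
    split=> [u v u01 v01|u /hu[]//|a1 b1 a2 b2 a3 b3 a11 b11 a21 b21 a31 b31 ab1 ab2 ab3].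
      have [-> -> _] := hb u v u01 v01; have [_ _ ->] := hb v u v01 u01.
      by [].
    have := hi _ _ _ _ _ _ a21 b21 a11 b11 a31 b31 ab2 ab1 ab3; lra.
  have m12 u v : in01 u -> in01 v -> Ct u v 1 = C12 u v.
    by move=> u01 v01; have [] := hm _ _ 1 u01 v01 (in01_1 R).
  have m13 u v : in01 u -> in01 v -> Ct u 1 v = C13 u v.
    by move=> u01 v01; have [] := hm _ 1 _ u01 (in01_1 R) v01.
  have m23 u v : in01 u -> in01 v -> Ct 1 u v = C23 u v.
    by move=> u01 v01; have [] := hm 1 _ _ (in01_1 R) u01 v01.
  have [C3 hC3 E3] := star_representation hCt2 m13
    (fun t z t01 z01 => m23 z t z01 t01 : _ = transp C23 t z).
  have [C2 hC2 E2] := star_representation hCt m12 m23.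
  have [C1 hC1 E1] := star_representation hCt1
    (fun x t x01 t01 => m12 t x t01 x01 : _ = transp C12 x t) m13.
  exists C1, C2, C3; split=> // u1 u2 u3 u1in u2in u3in.
  by rewrite -E1// -E2// -E3.
(* The [C2] form at [u3 = 1] and at [u1 = 1] yields [C12] and [C23]; the [C3] form at [u2 = 1]
   yields [C13]. *)
have := HC u1 u2 1 u1in u2in (in01_1 R); have := HC u1 1 u3 u1in (in01_1 R) u3in.
have := HC 1 u2 u3 (in01_1 R) u2in u3in.
move=> [_ [-> _]] [-> _] [_ [-> _]].
by rewrite (star_marginr h12 h23 hC2)// (star_marginr h13 h32 hC3)//
  (star_marginl h12 h23 hC2).
Qed.
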